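(* The affinity partial coherence $C^a_A$ is a partial coherence measure, i.e. it satisfies: (C1) $C^a_A(\rho^{ab})\ge0$ with equality iff $\rho^{ab}\in I^a_P$; (C2) $C^a_A(\Phi^a(\rho^{ab}))\le C^a_A(\rho^{ab})$ for every partial incoherent operation $\Phi^a$; (C3) $\sum_ip_iC^a_A(p_i^{-1}K_i\rho^{ab}K_i^\dagger)\le C^a_A(\rho^{ab})$, where $\{K_i\}$ are Kraus operators of a partial incoherent operation and $p_i=\mathrm{Tr}(K_i\rho^{ab}K_i^\dagger)$ (sum over $p_i>0$); (C4) $C^a_A(\sum_ip_i\rho^{ab}_i)\le\sum_ip_iC^a_A(\rho^{ab}_i)$ for every ensemble $\{p_i,\rho^{ab}_i\}$.
   Context: Bipartite finite-dimensional system $\mathcal H_a\otimes\mathcal H_b$ with a fixed orthonormal basis $\{|i\rangle\}$ of $\mathcal H_a$. Partial incoherent states: $I^a_P=\{\sigma:\sum_i(|i\rangle\langle i|\otimes I^b)\sigma(|i\rangle\langle i|\otimes I^b)=\sigma\}$. A CPTP map with Kraus operators $\{K_n\}$ is a partial incoherent operation if each $K_n$ maps $I^a_P$ into (nonnegative multiples of elements of) $I^a_P$, i.e. $K_n\sigma K_n^\dagger/\mathrm{Tr}(K_n\sigma K_n^\dagger)\in I^a_P$ whenever $\sigma\in I^a_P$ and $K_n\sigma K_n^\dagger\ne0$. $C^a_A(\rho^{ab})=\min_{\sigma\in I^a_P}(1-A^2(\rho^{ab},\sigma))$ with $A(\rho,\sigma)=\mathrm{Tr}(\sqrt\rho\sqrt\sigma)$.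 *)

(* Defs.v *)
From HB Require Import structures.
From mathcomp Require Import all_boot all_order all_algebra.
From Stdlib Require Import ClassicalEpsilon.
Set Implicit Arguments. Unset Strict Implicit. Unset Printing Implicit Defensive.
Import Order.TTheory GRing.Theory Num.Theory.
Local Open Scope ring_scope.

Section Defs.
Variable C : numClosedFieldType.

Definition adj (k l : nat) (A : 'M[C]_(k, l)) : 'M[C]_(l, k) :=
  map_mx Num.conj (A^T).

Definition psd (k : nat) (A : 'M[C]_k) : Prop :=
  adj A = A /\ forall v : 'rV[C]_k, 0 <= (v *m A *m adj v) 0 0.

Definition density (k : nat) (A : 'M[C]_k) : Prop := psd A /\ \tr A = 1.

Definition msqrt (k : nat) (A : 'M[C]_k) : 'M[C]_k :=
  epsilon (inhabits 0) (fun S : 'M[C]_k => psd S /\ S *m S = A).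

Definition affinity (k : nat) (rho sigma : 'M[C]_k) : C :=
  \tr (msqrt rho *m msqrt sigma).

(* Bipartite system H_a (dim m) (x) H_b (dim n); the product basis vector
   |i> (x) |j> has index i * n + j in 'I_(m * n).  Hence the a-component of
   an index x is x %/ n. *)
(* Pi_i = |i><i| (x) I_b *)
Definition projA (m n : nat) (i : 'I_m) : 'M[C]_(m * n) :=
  \matrix_(x, y) ((x == y) && (x %/ n == i)%N)%:R.

Definition dephA (m n : nat) (s : 'M[C]_(m * n)) : 'M[C]_(m * n) :=
  \sum_(i < m) @projA m n i *m s *m @projA m n i.
Arguments dephA : clear implicits.

Definition PIstate (m n : nat) (s : 'M[C]_(m * n)) : Prop :=
  density s /\ dephA m n s = s.
Arguments PIstate : clear implicits.

Definition krausmap (k r : nat) (K : 'I_r -> 'M[C]_k) (rho : 'M[C]_k) : 'M[C]_k :=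
  \sum_(l < r) K l *m rho *m adj (K l).

Definition cptp_kraus (k r : nat) (K : 'I_r -> 'M[C]_k) : Prop :=
  \sum_(l < r) adj (K l) *m K l = 1%:M.

Definition PIO (m n r : nat) (K : 'I_r -> 'M[C]_(m * n)) : Prop :=
  cptp_kraus K /\
  forall (l : 'I_r) (s : 'M[C]_(m * n)), PIstate m n s ->
    K l *m s *m adj (K l) != 0 ->
    PIstate m n ((\tr (K l *m s *m adj (K l)))^-1 *: (K l *m s *m adj (K l))).

Definition is_CA_min (m n : nat) (rho : 'M[C]_(m * n)) (c : C) : Prop :=
  (exists2 s, PIstate m n s & c = 1 - affinity rho s ^+ 2) /\
  (forall s, PIstate m n s -> c <= 1 - affinity rho s ^+ 2).
Arguments is_CA_min : clear implicits.

Definition CA (m n : nat) (rho : 'M[C]_(m * n)) : C :=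
  epsilon (inhabits 0) (is_CA_min m n rho).

End Defs.
Arguments dephA {C} m n s.
Arguments PIstate {C} m n s.
Arguments PIO {C} m n {r} K.
Arguments is_CA_min {C} m n rho c.
Arguments CA {C} m n rho.
Arguments projA {C} m n i.

(* Main.v *)
Require Import Defs.
From HB Require Import structures.
From mathcomp Require Import all_boot all_order all_algebra.
From mathcomp Require Import sesquilinear spectral.
From Stdlib Require Import ClassicalEpsilon.
Set Implicit Arguments. Unset Strict Implicit. Unset Printing Implicit Defensive.
Import Order.TTheory GRing.Theory Num.Theory.
Local Open Scope ring_scope.

(** With [D = dephA], optimality of [sigma ~ D(sqrt rho)^2] in the maximum of
    [Tr (sqrt rho sqrt sigma)] gives the closed form
    [CA rho = 1 - Tr (D(sqrt rho)^2)], which yields (C1).  The other parts rest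
    on the data processing inequality for the affinity: if a channel maps
    [s^2] to [s'^2] and [t^2] to [t'^2], then [Tr (s t) <= Tr (s' t')].
    It is Lieb's concavity theorem at exponent 1/2, and is obtained here from
    Ando's description of the geometric mean of the commuting operators "left
    multiplication by [s'^2]" and "right multiplication by [t'^2]", which only
    needs the eigenvalues of a self-adjoint superoperator.  Applied to the
    optimal [sigma], data processing along [rho |-> (+)_i K_i rho K_i^*] gives
    (C3), and along the partial trace [(+)_i rho_i |-> sum_i rho_i] it gives
    superadditivity of [Tr (D(sqrt rho)^2)], hence (C4) and (C2). *)

(** * Conjugate transpose and the Hilbert-Schmidt norm *)

Section Adjoint.
Variable C : numClosedFieldType.

Lemma adjE k l (A : 'M[C]_(k, l)) i j : adj A i j = (A j i)^*.
Proof. by rewrite !mxE. Qed.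

Lemma adjK k l (A : 'M[C]_(k, l)) : adj (adj A) = A.
Proof. by apply/matrixP => i j; rewrite !adjE conjCK. Qed.

Lemma adjM k l p (A : 'M[C]_(k, l)) (B : 'M_(l, p)) :
  adj (A *m B) = adj B *m adj A.
Proof. by rewrite /adj trmx_mul map_mxM. Qed.

Lemma adjD k l (A B : 'M[C]_(k, l)) : adj (A + B) = adj A + adj B.
Proof. by apply/matrixP => i j; rewrite !(adjE, mxE) rmorphD. Qed.

Lemma adjN k l (A : 'M[C]_(k, l)) : adj (- A) = - adj A.
Proof. by apply/matrixP => i j; rewrite !(adjE, mxE) rmorphN. Qed.

Lemma adjB k l (A B : 'M[C]_(k, l)) : adj (A - B) = adj A - adj B.
Proof. by rewrite adjD adjN. Qed.

Lemma adj_scale k l c (A : 'M[C]_(k, l)) : adj (c *: A) = c^* *: adj A.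
Proof. by apply/matrixP => i j; rewrite !(adjE, mxE) rmorphM. Qed.

Lemma adj_scalar k (c : C) : adj (c%:M : 'M_k) = (c^*)%:M.
Proof. by rewrite /adj tr_scalar_mx map_scalar_mx. Qed.

Lemma adj_1mx k : adj (1%:M : 'M[C]_k) = 1%:M.
Proof. by rewrite adj_scalar rmorph1. Qed.

Lemma adj_sum k l (I : Type) (r : seq I) P (F : I -> 'M[C]_(k, l)) :
  adj (\sum_(i <- r | P i) F i) = \sum_(i <- r | P i) adj (F i).
Proof.
apply/matrixP => i j; rewrite adjE !summxE rmorph_sum.
by apply: eq_bigr => *; rewrite adjE.
Qed.

Lemma adj_inv k (A : 'M[C]_k) : adj (invmx A) = invmx (adj A).
Proof. by rewrite /adj trmx_inv map_invmx. Qed.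

Lemma mxtrace_adj k (A : 'M[C]_k) : \tr (adj A) = (\tr A)^*.
Proof. by rewrite /mxtrace rmorph_sum; apply: eq_bigr => i _; rewrite adjE. Qed.

Lemma mxtr_mul_adjE k l (A : 'M[C]_(k, l)) :
  \tr (A *m adj A) = \sum_i \sum_j `|A i j| ^+ 2.
Proof.
rewrite /mxtrace; apply: eq_bigr => i _; rewrite mxE; apply: eq_bigr => j _.
by rewrite adjE normCK.
Qed.

Lemma mxtr_mul_adj_ge0 k l (A : 'M[C]_(k, l)) : 0 <= \tr (A *m adj A).
Proof.
by rewrite mxtr_mul_adjE; do 2!apply: sumr_ge0 => ? _; rewrite exprn_ge0.
Qed.

Lemma mxtr_mul_adj_eq0 k l (A : 'M[C]_(k, l)) :
  \tr (A *m adj A) = 0 -> A = 0.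
Proof.
rewrite mxtr_mul_adjE => /psumr_eq0P H; apply/matrixP => i j; rewrite mxE.
have /psumr_eq0P /(_ j isT) : \sum_j `|A i j| ^+ 2 = 0.
  by apply: H => // ? _; apply: sumr_ge0 => *; rewrite exprn_ge0.
by move=> H1; apply/eqP; rewrite -normr_eq0 -sqrf_eq0 H1 // => *; rewrite exprn_ge0.
Qed.

End Adjoint.

(** * Positive semidefinite matrices and their square roots *)

Section Psd.
Variable C : numClosedFieldType.

Lemma psd_adj k (A : 'M[C]_k) : psd A -> adj A = A.
Proof. by case. Qed.

Lemma psd_mul_adj k l (B : 'M[C]_(k, l)) : psd (B *m adj B).
Proof.
split=> [|v]; first by rewrite adjM adjK.
rewrite mulmxA -mulmxA -adjM.
by rewrite -[X in 0 <= X]trace_mx11 mxtr_mul_adj_ge0.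
Qed.

Lemma psd_sandwich k l (A : 'M[C]_k) (B : 'M[C]_(l, k)) :
  psd A -> psd (B *m A *m adj B).
Proof.
move=> [hA pA]; split=> [|v]; first by rewrite !adjM adjK hA mulmxA.
by have := pA (v *m B); rewrite adjM !mulmxA.
Qed.

Lemma psd_sqr k (H : 'M[C]_k) : adj H = H -> psd (H *m H).
Proof. by move=> hH; rewrite -{2}hH; apply: psd_mul_adj. Qed.

Lemma psd0 k : psd (0 : 'M[C]_k).
Proof.
by split=> [|v]; rewrite ?mulmx0 ?mul0mx ?mxE // /adj trmx0 map_mx0.
Qed.

Lemma psdD k (A B : 'M[C]_k) : psd A -> psd B -> psd (A + B).
Proof.
move=> [hA pA] [hB pB]; split=> [|v]; first by rewrite adjD hA hB.
by rewrite mulmxDr mulmxDl mxE addr_ge0.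
Qed.

Lemma psd_sum k (I : Type) (r : seq I) (P : pred I) (F : I -> 'M[C]_k) :
  (forall i, P i -> psd (F i)) -> psd (\sum_(i <- r | P i) F i).
Proof. by move=> H; apply: big_ind H; [apply: psd0 | apply: psdD]. Qed.

Lemma psdZ k (c : C) (A : 'M[C]_k) : 0 <= c -> psd A -> psd (c *: A).
Proof.
move=> c0 [hA pA]; split=> [|v]; first by rewrite adj_scale hA geC0_conj.
by rewrite -scalemxAr -scalemxAl mxE mulr_ge0.
Qed.

Lemma psd_scalar k (c : C) : 0 <= c -> psd (c%:M : 'M[C]_k).
Proof.
move=> c0; rewrite -scalemx1; apply: psdZ => //.
by rewrite -[1%:M]mulmx1; apply: psd_sqr; rewrite adj_1mx.
Qed.

Lemma hermitian_diag k (A : 'M[C]_k) : adj A = A ->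
  exists (U : 'M[C]_k) (d : 'rV[C]_k),
    [/\ U *m adj U = 1%:M, adj U *m U = 1%:M & A = adj U *m diag_mx d *m U].
Proof.
move=> hA; have hA' : A \is hermsymmx.
  by apply/is_hermitianmxP; rewrite expr0 scale1r.
have /orthomx_spectralP E := hermitian_normalmx hA'.
have U := spectral_unitarymx A.
have adjE' : invmx (spectralmx A) = adj (spectralmx A) by rewrite invmx_unitary.
exists (spectralmx A), (spectral_diag A); rewrite -adjE'; split=> //.
  by rewrite mulmxV ?spectral_unit.
by rewrite mulVmx ?spectral_unit.
Qed.

Lemma psd_diag k (A : 'M[C]_k) : psd A ->
  exists (U : 'M[C]_k) (d : 'rV[C]_k),
    [/\ U *m adj U = 1%:M, adj U *m U = 1%:M, A = adj U *m diag_mx d *m U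
      & forall i, 0 <= d 0 i].
Proof.
move=> [hA pA]; have [U [d [U1 U2 E]]] := hermitian_diag hA.
(* The eigenvalue [d 0 i] is the value of the quadratic form at the i-th row of [U]. *)
exists U, d; split=> // i; have := pA (delta_mx 0 i *m U).
rewrite E adjM !mulmxA -(mulmxA _ U (adj U)) U1 mulmx1 -(mulmxA _ U (adj U)) U1.
rewrite mulmx1 -rowE row_diag_mx -scalemxAl mxE.
rewrite [X in _ * X](_ : _ = 1) ?mulr1 // mxE (bigD1 i) //= big1.
  by rewrite addr0 !mxE !eqxx /= conjC1 mulr1.
by move=> j /negPf ji; rewrite !mxE ji andbF mul0r.
Qed.

Lemma psd_sqrtP k (A : 'M[C]_k) : psd A ->
  exists2 S : 'M[C]_k, psd S & S *m S = A.
Proof.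
move=> /psd_diag[U [d [U1 U2 -> d0]]].
(* Fourth roots of the eigenvalues: the root of [A] then has the shape [B *m adj B], which is psd by
   form. *)
pose e : 'rV[C]_k := map_mx (fun x => sqrtC (sqrtC x)) d.
pose B := adj U *m diag_mx e.
have he : adj (diag_mx e) = diag_mx e.
  rewrite /adj tr_diag_mx map_diag_mx; congr diag_mx; apply/rowP => i.
  by rewrite !mxE; apply: geC0_conj; rewrite !sqrtC_ge0.
have BB : B *m adj B *m (B *m adj B) = adj U *m diag_mx d *m U.
  rewrite /B adjM adjK he -!mulmxA !(mulmxA U) U1 !mul1mx.
  rewrite !mulmxA -3!(mulmxA (adj U)); congr (_ *m _ *m _).
  rewrite !mulmx_diag; congr diag_mx; apply/rowP => i; rewrite !mxE.
  rewrite -[RHS]sqrtCK -[X in X ^+ 2]sqrtCK -exprM.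
  by rewrite !exprS expr0 mulr1 !mulrA.
by exists (B *m adj B) => //; apply: psd_mul_adj.
Qed.

Lemma msqrtP k (A : 'M[C]_k) : psd A ->
  psd (msqrt A) /\ msqrt A *m msqrt A = A.
Proof.
move=> /psd_sqrtP[S pS E].
by apply: (epsilon_spec (inhabits 0) (fun S => psd S /\ S *m S = A)); exists S.
Qed.

Lemma psd_trM_ge0 k (A B : 'M[C]_k) : psd A -> psd B -> 0 <= \tr (A *m B).
Proof.
move=> /psd_sqrtP[S [hS _] <-] /psd_sqrtP[T [hT _] <-].
rewrite (_ : \tr _ = \tr (T *m S *m adj (T *m S))) ?mxtr_mul_adj_ge0 //.
by rewrite adjM hS hT mulmxA mxtrace_mulC !mulmxA.
Qed.

Lemma psd_tr_ge0 k (A : 'M[C]_k) : psd A -> 0 <= \tr A.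
Proof.
by move=> pA; rewrite -[A]mulmx1; apply: psd_trM_ge0 => //; apply: psd_scalar.
Qed.

Lemma psd_tr0 k (A : 'M[C]_k) : psd A -> \tr A = 0 -> A = 0.
Proof.
move=> /psd_sqrtP[S [hS _] <-]; rewrite -{2}hS => /mxtr_mul_adj_eq0 ->.
by rewrite mul0mx.
Qed.

(** In eigenbases of [S] and [T] the hypothesis reads d_i^2 y_ij = y_ij e_j^2, so y_ij = 0 or d_i =
    e_j, the eigenvalues being nonnegative. The case X = 1 gives uniqueness of psd roots; the case S
    = T shows that a root commutes with whatever commutes with its square. *)
Lemma sqrt_intertwine k l (S : 'M[C]_k) (T : 'M[C]_l) (X : 'M[C]_(k, l)) :
  psd S -> psd T -> S *m S *m X = X *m (T *m T) -> S *m X = X *m T.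
Proof.
move=> /psd_diag[U [d [U1 U2 -> d0]]] /psd_diag[V [e [V1 V2 -> e0]]] H.
have UK p (Z : 'M_(k, p)) : U *m (adj U *m Z) = Z by rewrite mulmxA U1 mul1mx.
have VK p (Z : 'M_(l, p)) : V *m (adj V *m Z) = Z by rewrite mulmxA V1 mul1mx.
pose Y := U *m X *m adj V.
have XY : X = adj U *m Y *m V by rewrite /Y !mulmxA U2 mul1mx -mulmxA V2 mulmx1.
have sq : diag_mx d *m diag_mx d *m Y = Y *m (diag_mx e *m diag_mx e).
  have := congr1 (fun M => U *m M *m adj V) H.
  by rewrite /= -!mulmxA !UK !VK V1 mulmx1 /Y !mulmxA.
clearbody Y; suff dY : diag_mx d *m Y = Y *m diag_mx e.
  by rewrite XY -!mulmxA UK VK !mulmxA -(mulmxA (adj U) _ Y) dY !mulmxA.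
apply/matrixP => i j; move/matrixP: sq => /(_ i j).
rewrite !mulmx_diag !mul_diag_mx !mul_mx_diag !mxE [Y i j * _]mulrC -!expr2.
move=> /eqP; rewrite -subr_eq0 -mulrBl mulf_eq0 subr_eq0 => /orP[|/eqP ->].
  by rewrite eqrXn2 // => /eqP ->; rewrite mulrC.
by rewrite mulr0 mul0r.
Qed.

Lemma psd_sqrt_unique k (S T : 'M[C]_k) :
  psd S -> psd T -> S *m S = T *m T -> S = T.
Proof.
move=> pS pT E; have := @sqrt_intertwine k k S T 1%:M pS pT.
by rewrite !mulmx1 !mul1mx; apply.
Qed.

(** Uniqueness of the psd root determines the choice made by [epsilon] in [msqrt]. *)
Lemma msqrt_sqr k (S : 'M[C]_k) : psd S -> msqrt (S *m S) = S.
Proof.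
move=> pS; have [pR R2] := msqrtP (psd_sqr (psd_adj pS)).
exact: psd_sqrt_unique.
Qed.

Lemma msqrtZ k (c : C) (A : 'M[C]_k) : 0 <= c -> psd A ->
  msqrt (c *: A) = sqrtC c *: msqrt A.
Proof.
move=> c0 /msqrtP[pS {1}<-].
rewrite -[in LHS](sqrtCK c) expr2 -scalerA scalemxAl scalemxAr msqrt_sqr //.
by apply: psdZ; rewrite ?sqrtC_ge0.
Qed.

End Psd.

(** * Self-adjoint superoperators and their spectrum *)

Section SelfAdjoint.
Variable C : numClosedFieldType.

Lemma mxvec_mul_adj k l (A B : 'M[C]_(k, l)) :
  mxvec A *m adj (mxvec B) = (\tr (A *m adj B))%:M.
Proof.
apply/matrixP => i j; rewrite !ord1 mxE mxE eqxx mulr1n.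
rewrite (reindex _ (curry_mxvec_bij k l)) /= /mxtrace.
under [RHS]eq_bigr do rewrite mxE.
rewrite pair_big /=; apply: eq_bigr => -[a b] _ /=.
by rewrite !adjE !mxvecE.
Qed.

Lemma psd_diag_mx k (d : 'rV[C]_k) : (forall i, 0 <= d 0 i) -> psd (diag_mx d).
Proof.
move=> d0; pose e : 'rV[C]_k := map_mx sqrtC d.
have he : adj (diag_mx e) = diag_mx e.
  rewrite /adj tr_diag_mx map_diag_mx; congr diag_mx; apply/rowP => i.
  by rewrite !mxE; apply: geC0_conj; rewrite sqrtC_ge0.
suff -> : diag_mx d = diag_mx e *m diag_mx e by apply: psd_sqr.
by rewrite mulmx_diag; congr diag_mx; apply/rowP => i; rewrite !mxE -expr2 sqrtCK.
Qed.

(** Vectorisation preserves the Hilbert-Schmidt inner product, so [T] becomes a Hermitian matrix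
    [M]. Its eigenvectors, reshaped into matrices, are eigenvectors of [T]; hence all eigenvalues
    are real and at most 1, and [1%:M - M] is psd. *)
Lemma selfadjoint_le1 k (T : 'M[C]_k -> 'M[C]_k) : linear T ->
  (forall A B, \tr (T A *m adj B) = \tr (A *m adj (T B))) ->
  (forall (a : C) (W : 'M[C]_k), a^* = a -> W != 0 -> T W = a *: W -> a <= 1) ->
  forall W, \tr (T W *m adj W) <= \tr (W *m adj W).
Proof.
move=> lT sT eigT.
pose T' : {linear 'M[C]_k -> 'M[C]_k} :=
  HB.pack T (GRing.isLinear.Build _ _ _ _ T lT).
pose M := lin_mx T'.
have TM A : mxvec A *m M = mxvec (T A) by rewrite mul_vec_lin.
have hM : adj M = M.
  have uv (u v : 'rV_(k * k)) : u *m M *m adj v = u *m adj M *m adj v.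
    rewrite -[u]vec_mxK -[v]vec_mxK TM -mulmxA -adjM TM !mxvec_mul_adj.
    by rewrite sT.
  apply/row_matrixP => i; apply/eqP; rewrite !rowE -subr_eq0; apply/eqP.
  apply: mxtr_mul_adj_eq0; rewrite -mulmxBr.
  by rewrite mulmxBr mulmxBl uv subrr mxtrace0.
have [U [d [U1 U2 E]]] := hermitian_diag hM.
have dreal i : (d 0 i)^* = d 0 i.
  have : adj (diag_mx d) = diag_mx d.
    have -> : diag_mx d = U *m M *m adj U.
      by rewrite E !mulmxA U1 mul1mx -mulmxA U1 mulmx1.
    by rewrite !adjM adjK hM mulmxA.
  by move=> /matrixP /(_ i i); rewrite !mxE eqxx mulr1n.
have d1 i : d 0 i <= 1.
  pose w : 'rV_(k * k) := delta_mx 0 i *m U.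
  have w0 : w != 0.
    apply/eqP => /(congr1 (mulmx^~ (adj U))); rewrite -mulmxA U1 mulmx1 mul0mx.
    by move=> /matrixP /(_ 0 i) /eqP; rewrite !mxE !eqxx oner_eq0.
  apply: (eigT _ (vec_mx w)) => //.
    apply: contraNneq w0 => w0; by rewrite -[w]vec_mxK w0 linear0.
  apply: (can_inj mxvecK); rewrite -TM linearZ /= vec_mxK E /w.
  rewrite !mulmxA -(mulmxA _ U) U1 mulmx1 -rowE row_diag_mx.
  by rewrite -scalemxAl.
move=> W; rewrite -subr_ge0.
have -> : \tr (W *m adj W) - \tr (T W *m adj W) =
    (mxvec W *m (1%:M - M) *m adj (mxvec W)) 0 0.
  rewrite mulmxBr mulmxBl mulmx1 TM !mxvec_mul_adj.
  by rewrite !mxE eqxx !mulr1n.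
suff : psd (1%:M - M) by case.
have -> : 1%:M - M = adj U *m diag_mx (const_mx 1 - d) *m adj (adj U).
  rewrite adjK E -U2 -[in X in X - _](mulmx1 (adj U)) -mulmxBl -mulmxBr.
  congr (_ *m _ *m _); apply/matrixP => i j; rewrite !mxE.
  by case: (i == j); rewrite /= ?mulr1n ?mulr0n ?subr0.
by apply/psd_sandwich/psd_diag_mx => i; rewrite !mxE subr_ge0.
Qed.

End SelfAdjoint.

(** * Completely positive maps and the Kadison-Schwarz inequality *)

Section Kraus.
Variable C : numClosedFieldType.

(** Kraus operators are rectangular here, unlike in [krausmap]: the channels used below map into or
    out of a larger direct sum. *)
Definition kraus k l r (L : 'I_r -> 'M[C]_(l, k)) (A : 'M[C]_k) : 'M[C]_l :=
  \sum_(i < r) L i *m A *m adj (L i).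

(** The adjoint of [kraus L] for the trace pairing (Heisenberg picture); it is unital when [kraus L]
    preserves the trace. *)
Definition kraus_dual k l r (L : 'I_r -> 'M[C]_(l, k)) : 'M[C]_l -> 'M[C]_k :=
  kraus (fun i => adj (L i)).

Lemma kraus_is_linear k l r (L : 'I_r -> 'M[C]_(l, k)) : linear (kraus L).
Proof.
move=> a A B; rewrite /kraus scaler_sumr -big_split /=; apply: eq_bigr => i _.
by rewrite mulmxDr mulmxDl -scalemxAr -scalemxAl.
Qed.

Lemma adj_kraus k l r (L : 'I_r -> 'M[C]_(l, k)) A :
  adj (kraus L A) = kraus L (adj A).
Proof.
by rewrite adj_sum; apply: eq_bigr => i _; rewrite !adjM adjK mulmxA.
Qed.

Lemma tr_kraus k l r (L : 'I_r -> 'M[C]_(l, k)) A Z :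
  \tr (kraus L A *m Z) = \tr (A *m kraus_dual L Z).
Proof.
rewrite mulmx_suml mulmx_sumr !raddf_sum; apply: eq_bigr => i _ /=.
by rewrite adjK mxtrace_mulC !mulmxA mxtrace_mulC !mulmxA mxtrace_mulC !mulmxA.
Qed.

Section Unital.
Variables (k l r : nat) (L : 'I_r -> 'M[C]_(l, k)).
Hypothesis L1 : \sum_(i < r) adj (L i) *m L i = 1%:M.

Lemma kraus_dual1 : kraus_dual L 1%:M = 1%:M.
Proof.
by rewrite -[RHS]L1; apply: eq_bigr => i _; rewrite mulmx1 adjK.
Qed.

(* Kadison-Schwarz: the gap is the sum of the squares of the operators [s B_i]. *)
Lemma kraus_dual_schwarz (W : 'M[C]_l) (s : 'M[C]_k) :
  \tr (s *m kraus_dual L W *m adj (s *m kraus_dual L W)) <=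
  \tr (s *m kraus_dual L (W *m adj W) *m adj s).
Proof.
rewrite -subr_ge0.
pose B i := adj (L i) *m W - kraus_dual L W *m adj (L i).
suff -> : \tr (s *m kraus_dual L (W *m adj W) *m adj s) -
    \tr (s *m kraus_dual L W *m adj (s *m kraus_dual L W)) =
    \sum_(i < r) \tr ((s *m B i) *m adj (s *m B i)).
  by apply: sumr_ge0 => i _; apply: mxtr_mul_adj_ge0.
rewrite -raddf_sum -raddfB /=; congr (\tr _).
rewrite adjM -mulmxA -(mulmxA s _ (_ *m _)) -mulmxBr.
under eq_bigr do rewrite adjM -mulmxA.
rewrite -mulmx_sumr; congr (_ *m _).
under eq_bigr do rewrite mulmxA.
rewrite -mulmx_suml [in X in _ - X]mulmxA -mulmxBl; congr (_ *m _).
set P := kraus_dual L W.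
have aP : adj P = \sum_(i < r) adj (L i) *m adj W *m L i.
  by rewrite adj_kraus; apply: eq_bigr => i _; rewrite adjK.
(* Summed over [i], each of the two cross terms gives minus P adj(P), and the last term gives P
   adj(P) because the L_i resolve the identity. *)
have B2 i : B i *m adj (B i) = adj (L i) *m (W *m adj W) *m L i
   - (adj (L i) *m W *m L i) *m adj P - P *m (adj (L i) *m adj W *m L i)
   + P *m (adj (L i) *m L i) *m adj P.
  rewrite /B -/P adjB !adjM adjK mulmxBl !mulmxBr !mulmxA opprB addrA.
  by rewrite addrAC.
under [RHS]eq_bigr do rewrite B2.
rewrite !big_split /= -mulmx_suml -mulmx_sumr L1 mulmx1.
rewrite !sumrN -mulmx_suml -mulmx_sumr -aP.
rewrite (_ : \sum_(i < r) adj (L i) *m W *m L i = P); last first.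
  by apply: eq_bigr => i _; rewrite adjK.
rewrite addrNK; congr (_ - _).
by apply: eq_bigr => i _; rewrite adjK.
Qed.

(** Kadison-Schwarz and duality bound the left side by the trace of W adj(W) against s'^2, and s'^2
    <= (s' + e)^2 since [s'] is psd and [e] nonnegative. *)
Lemma kraus_dual_bound (s : 'M[C]_k) (s' : 'M[C]_l) (e : C) (W : 'M[C]_l) :
  adj s = s -> psd s' -> kraus L (s *m s) = s' *m s' -> 0 <= e ->
  \tr (s *m kraus_dual L W *m adj (s *m kraus_dual L W)) <=
  \tr ((s' + e%:M) *m W *m adj ((s' + e%:M) *m W)).
Proof.
move=> hs ps' E e0; apply: le_trans (kraus_dual_schwarz W s) _.
rewrite hs mxtrace_mulC mulmxA -tr_kraus E -subr_ge0.
set p := s' + e%:M.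
rewrite (_ : \tr (p *m W *m adj (p *m W)) = \tr (W *m adj W *m (adj p *m p))).
  2: by rewrite adjM -!mulmxA mxtrace_mulC !mulmxA.
rewrite (mxtrace_mulC (s' *m s')) -raddfB -mulmxBr /=.
apply: psd_trM_ge0; first exact: psd_mul_adj.
have he : adj (e%:M : 'M[C]_l) = e%:M by rewrite adj_scalar geC0_conj.
rewrite /p adjD (psd_adj ps') he mulmxDl !mulmxDr.
rewrite addrC -!addrA addKr scalar_mxC.
rewrite !mul_scalar_mx; apply: psdD; first exact: psdZ.
by apply: psdD; [apply: psdZ | apply/psdZ/psd_scalar].
Qed.

End Unital.
End Kraus.

(** * Data processing inequality for the affinity *)

Section DataProcessing.
Variable C : numClosedFieldType.

Lemma psd_shift_sqrt k (s : 'M[C]_k) (e : C) : psd s -> 0 < e ->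
  exists R : 'M[C]_k, [/\ adj R = R, R *m R = s + e%:M & R \in unitmx].
Proof.
move=> ps e0; have [R [hR _] RR] := psd_sqrtP (psdD ps (psd_scalar k (ltW e0))).
exists R; split=> //; suff : s + e%:M \in unitmx.
  by rewrite -RR unitmx_mul => /andP[].
rewrite -row_free_unit -kermx_eq0; apply/eqP.
(* On the left kernel [K] of s + e, the trace of K s adj(K) plus e times the squared norm of [K]
   vanishes; both terms are nonnegative, so K = 0. *)
set K := kermx _; have := mulmx_ker (s + e%:M); rewrite -/K => Ks.
have : \tr (K *m (s + e%:M) *m adj K) = 0 by rewrite Ks mul0mx mxtrace0.
rewrite mulmxDr mulmxDl raddfD /= mul_mx_scalar -scalemxAl mxtraceZ.
move=> /eqP; rewrite paddr_eq0; last 2 first.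
- exact/psd_tr_ge0/psd_sandwich.
- by apply: mulr_ge0; [apply: ltW | apply: mxtr_mul_adj_ge0].
by move=> /andP[_]; rewrite mulf_eq0 (gt_eqF e0) => /eqP/mxtr_mul_adj_eq0.
Qed.

(** The limit e -> 0, carried out with a single explicit [e] so that it holds in any
    [numClosedFieldType]. *)
Lemma ler_of_quadratic (x y b c : C) : x \is Num.real -> y \is Num.real ->
  0 <= b -> 0 <= c ->
  (forall e, 0 < e -> x <= y + e * b + e ^+ 2 * c) -> x <= y.
Proof.
move=> rx ry b0 c0 H; rewrite real_leNgt //; apply/negP => yx.
have d0 : 0 < x - y by rewrite subr_gt0.
have D0 : 0 < b + c + (x - y) + 1.
  by rewrite -addrA ltr_wpDl ?addr_ge0 // addr_gt0.
(* The summand x - y in the denominator makes e <= 1, so that e^2 c <= e c; the denominator exceeds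
   b + c, so that e (b + c) < x - y. *)
pose e := (x - y) / (b + c + (x - y) + 1).
have e0 : 0 < e by rewrite divr_gt0.
have e1 : e <= 1.
  by rewrite ler_pdivrMr // mul1r -addrA addrCA lerDl !addr_ge0.
have := H e e0; apply/negP; rewrite -real_ltNge //; last first.
  by rewrite !realD // ger0_real // mulr_ge0 // ?exprn_ge0 // (ltW e0).
apply: (@le_lt_trans _ _ (y + e * (b + c))).
  by rewrite -addrA lerD2l mulrDr lerD2l ler_wpM2r // expr2 ler_piMl // ltW.
rewrite addrC -ltrBrDr /e mulrAC ltr_pdivrMr // ltr_pM2l //.
by rewrite -addrA ltrDl addr_gt0.
Qed.

Section Channel.
Variables (k l r : nat) (L : 'I_r -> 'M[C]_(l, k)).
Hypothesis L1 : \sum_(i < r) adj (L i) *m L i = 1%:M.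
Variables (s t : 'M[C]_k) (s' t' : 'M[C]_l).
Hypotheses (ps : psd s) (pt : psd t) (ps' : psd s') (pt' : psd t').
Hypotheses (Es : kraus L (s *m s) = s' *m s') (Et : kraus L (t *m t) = t' *m t').
Let Psi := kraus_dual L.
(** The map X |-> s X t is the geometric mean of left multiplication by s^2 and right multiplication
    by t^2; [T] is its compression along the channel. Since Psi(1) = 1, the trace of T(1) is Tr (s
    t), so it suffices to dominate [T] by Z |-> s' Z t', up to the shift by [e]. *)
Let T (Z : 'M[C]_l) := kraus L (s *m Psi Z *m t).

Let TE (Z W : 'M[C]_l) :
  \tr (T Z *m adj W) = \tr (s *m Psi Z *m (t *m adj (Psi W))).
Proof. by rewrite /T tr_kraus /Psi adj_kraus !mulmxA. Qed.

Let T_selfadjoint (Z W : 'M[C]_l) : \tr (T Z *m adj W) = \tr (Z *m adj (T W)).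
Proof.
rewrite -[in RHS](adjK Z) -adjM mxtrace_adj !TE -mxtrace_adj !adjM adjK.
by rewrite (psd_adj ps) (psd_adj pt) !mulmxA -mulmxA [RHS]mxtrace_mulC !mulmxA.
Qed.

(* With [W := p^-1 Z q], both [tr (p W)(p W)^*] and [tr (Z q)(Z q)^*] are the
   same number [kappa], so the mixed term [a kappa] is at most [kappa] by
   AM-GM. *)
Let T_eigenvalue_le1 (e a : C) (Z : 'M[C]_l) : 0 < e -> a^* = a -> Z != 0 ->
  T Z = a *: ((s' + e%:M) *m Z *m (t' + e%:M)) -> a <= 1.
Proof.
move=> e0 ha Z0 TZ; set p := s' + _ in TZ; set q := t' + _ in TZ.
have he : adj (e%:M : 'M[C]_l) = e%:M by rewrite adj_scalar geC0_conj // ltW.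
have hp : adj p = p by rewrite adjD he psd_adj.
have hq : adj q = q by rewrite adjD he psd_adj.
have Up : p \in unitmx.
  by have [R [_ RR UR]] := psd_shift_sqrt ps' e0; rewrite /p -RR unitmx_mul UR.
have Uq : q \in unitmx.
  by have [R [_ RR UR]] := psd_shift_sqrt pt' e0; rewrite /q -RR unitmx_mul UR.
pose W := invmx p *m Z *m q.
have pW : p *m W = Z *m q by rewrite /W !mulmxA mulmxV // mul1mx.
pose kappa := \tr (Z *m q *m adj (Z *m q)).
have k0 : 0 < kappa.
  rewrite lt_def mxtr_mul_adj_ge0 andbT; apply: contraNneq Z0.
  move=> /mxtr_mul_adj_eq0 /(congr1 (mulmx^~ (invmx q))).
  by rewrite mulmxK // mul0mx => ->.
have TW : \tr (T Z *m adj W) = a * kappa.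
  rewrite TZ -scalemxAl mxtraceZ /W !adjM adj_inv hp hq -!mulmxA mxtrace_mulC.
  by rewrite !mulmxA mulmxKV // /kappa adjM hq !mulmxA.
have B1 : \tr (s *m Psi W *m adj (s *m Psi W)) <= kappa.
  by rewrite /kappa -pW; apply: kraus_dual_bound => //; [case: ps | apply: ltW].
have B2 : \tr (t *m Psi (adj Z) *m adj (t *m Psi (adj Z))) <= kappa.
  rewrite (_ : kappa = \tr (q *m adj Z *m adj (q *m adj Z))).
    by apply: kraus_dual_bound => //; [case: pt | apply: ltW].
  by rewrite /kappa !adjM !adjK hq [RHS]mxtrace_mulC.
pose E := s *m Psi W - adj (t *m Psi (adj Z)).
have := mxtr_mul_adj_ge0 E.
have tPZ : adj (t *m Psi (adj Z)) = Psi Z *m t.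
  by rewrite adjM adj_kraus adjK (psd_adj pt).
have X1 : \tr (Psi Z *m t *m adj (s *m Psi W)) = a * kappa.
  rewrite -TW TE adjM (psd_adj ps) !mulmxA mxtrace_mulC !mulmxA //.
have X2 : \tr (s *m Psi W *m adj (Psi Z *m t)) = a * kappa.
  rewrite -[RHS]conjCK; have <- : a * kappa = (a * kappa)^*.
    by rewrite rmorphM /= ha (geC0_conj (ltW k0)).
  by rewrite -X1 -mxtrace_adj [in RHS]adjM adjK.
have X3 : \tr (adj (t *m Psi (adj Z)) *m adj (adj (t *m Psi (adj Z)))) =
    \tr (t *m Psi (adj Z) *m adj (t *m Psi (adj Z))).
  by rewrite adjK mxtrace_mulC.
rewrite /E adjB mulmxBl !mulmxBr !raddfB /= X3 !tPZ X1 X2.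
rewrite opprK [- _ + \tr _]addrC addrACA -opprD subr_ge0 => H.
move: B2; rewrite tPZ => B2.
have := le_trans H (lerD B1 B2).
by rewrite -!mulr2n lerMn2r /= -[X in _ <= X]mul1r ler_pM2r.
Qed.

Lemma affinity_kraus : \tr (s *m t) <= \tr (s' *m t').
Proof.
(* The shift makes [s'] and [t'] invertible; [e] then tends to 0. *)
suff H (e : C) : 0 < e -> \tr (s *m t) <= \tr ((s' + e%:M) *m (t' + e%:M)).
  apply: (@ler_of_quadratic _ _ (\tr s' + \tr t') (l%:R)).
  - exact/ger0_real/psd_trM_ge0.
  - exact/ger0_real/psd_trM_ge0.
  - by apply: addr_ge0; apply: psd_tr_ge0.
  - exact: ler0n.
  move=> e e0; apply: le_trans (H e e0) _.
  rewrite mulmxDl !mulmxDr !raddfD /= -scalar_mxM mxtrace_scalar.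
  rewrite mul_mx_scalar mul_scalar_mx !mxtraceZ mulr_natr expr2.
  by rewrite mulrDr !addrA.
move=> e0.
have [P [hP PP UP]] := psd_shift_sqrt ps' e0.
have [Q [hQ QQ UQ]] := psd_shift_sqrt pt' e0.
rewrite -PP -QQ.
(* Normalising [T] by the roots of the shifted s' and t' turns the domination into the bound 1 on
   the spectrum of [Y]. *)
pose Y Z := invmx P *m T (invmx P *m Z *m invmx Q) *m invmx Q.
have hPi : adj (invmx P) = invmx P by rewrite adj_inv hP.
have hQi : adj (invmx Q) = invmx Q by rewrite adj_inv hQ.
have YT Z W : \tr (Y Z *m adj W) =
    \tr (T (invmx P *m Z *m invmx Q) *m adj (invmx P *m W *m invmx Q)).
  by rewrite /Y -!mulmxA mxtrace_mulC !adjM hPi hQi !mulmxA.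
have lY : linear Y.
  move=> a A B; rewrite /Y /T /Psi mulmxDr mulmxDl -scalemxAr -scalemxAl.
  rewrite [kraus_dual L _]kraus_is_linear mulmxDr mulmxDl -scalemxAr -scalemxAl.
  by rewrite kraus_is_linear mulmxDr mulmxDl -scalemxAr -scalemxAl.
have sY A B : \tr (Y A *m adj B) = \tr (A *m adj (Y B)).
  rewrite YT T_selfadjoint -[RHS]conjCK -mxtrace_adj adjM adjK YT.
  by rewrite -mxtrace_adj adjM adjK.
have eY (a : C) (W : 'M[C]_l) : a^* = a -> W != 0 -> Y W = a *: W -> a <= 1.
  (* An eigenvector W of [Y] corresponds to Z = P^-1 W Q^-1, for which T(Z) = a P^2 Z Q^2. *)
  move=> ha W0 YW; apply: (T_eigenvalue_le1 e0 ha (Z := invmx P *m W *m invmx Q)).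
    apply: contraNneq W0 => /(congr1 (fun X => P *m X *m Q)).
    by rewrite mulmx0 mul0mx !mulmxA mulmxV // mul1mx mulmxKV // => ->.
  rewrite -PP -QQ !mulmxA mulmxK // mulmxKV //.
  have := congr1 (fun X => P *m X *m Q) YW.
  rewrite /Y /= !mulmxA mulmxV // mul1mx mulmxKV // => ->.
  by rewrite -scalemxAr -scalemxAl.
(* At the test matrix P Q the argument of [T] is the identity, so the quadratic form of [Y] equals
   Tr (s t). *)
have := selfadjoint_le1 lY sY eY (P *m Q).
rewrite YT !mulmxA mulVmx // mul1mx mulmxV // TE.
rewrite /Psi !(kraus_dual1 L1) adj_1mx !mulmx1.
rewrite adjM hP hQ [X in _ <= X -> _](_ : _ = \tr (P *m P *m (Q *m Q))) ?mulmxA //.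
by rewrite mxtrace_mulC !mulmxA.
Qed.

End Channel.
End DataProcessing.

(** * Direct sums of square matrices as block diagonal matrices *)

Section DirectSum.
Variables (C : numClosedFieldType) (r q : nat).

(** The isometry onto the i-th block; [mxvec_index] serves as the bijection from pairs (block,
    position) to indices below r * q. *)
Definition block_inj (i : 'I_r) : 'M[C]_(r * q, q) :=
  \matrix_(x, j) (x == mxvec_index i j)%:R.

Lemma mxvec_index_eq (i i' : 'I_r) (j j' : 'I_q) :
  (mxvec_index i j == mxvec_index i' j') = (i == i') && (j == j').
Proof.
have [g gK _] := curry_mxvec_bij r q.
have inj := can_inj (fun x => gK x isT).
by rewrite -[RHS]/((i, j) == (i', j')) -(inj_eq inj).
Qed.

Lemma block_inj_ortho i k :
  adj (block_inj i) *m block_inj k = (i == k)%:R%:M.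
Proof.
apply/matrixP => a b; rewrite mxE (bigD1 (mxvec_index i a)) //= big1.
  rewrite addr0 adjE !mxE eqxx conjC1 mul1r mxvec_index_eq.
  by case: (i == k); case: (a == b).
by move=> x /negPf xi; rewrite adjE !mxE xi conjC0 mul0r.
Qed.

Lemma block_inj_sum : \sum_i block_inj i *m adj (block_inj i) = 1%:M.
Proof.
apply/matrixP => x y; rewrite summxE mxE.
transitivity (\sum_i \sum_j ((x == mxvec_index i j) && (y == mxvec_index i j))%:R : C).
  apply: eq_bigr => i _; rewrite mxE; apply: eq_bigr => j _.
  by rewrite adjE !mxE conjC_nat -natrM mulnb.
rewrite pair_big /=; case/mxvec_indexP: x => a b.
rewrite (bigD1 (a, b)) //= eqxx big1 ?addr0 1?eq_sym //.
move=> [c d] /negPf ne.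
by rewrite /= mxvec_index_eq -[_ && (b == d)]/((a, b) == (c, d)) eq_sym ne.
Qed.

Definition direct_sum (F : 'I_r -> 'M[C]_q) : 'M[C]_(r * q) :=
  \sum_i block_inj i *m F i *m adj (block_inj i).

Lemma direct_sum_block F i :
  adj (block_inj i) *m direct_sum F *m block_inj i = F i.
Proof.
rewrite mulmx_sumr mulmx_suml (bigD1 i) //= big1 => [|k /negPf ki].
  rewrite addr0 -!mulmxA block_inj_ortho eqxx mulmx1 mulmxA.
  by rewrite block_inj_ortho eqxx mul1mx.
by rewrite !mulmxA block_inj_ortho eq_sym ki raddf0 !mul0mx.
Qed.

Lemma direct_sumM F G :
  direct_sum F *m direct_sum G = direct_sum (fun i => F i *m G i).
Proof.
rewrite mulmx_suml; apply: eq_bigr => i _.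
rewrite mulmx_sumr (bigD1 i) //= big1 => [|k /negPf ki].
  rewrite addr0 !mulmxA -(mulmxA _ (adj (block_inj i))) block_inj_ortho eqxx.
  by rewrite mulmx1.
rewrite !mulmxA -(mulmxA _ (adj (block_inj i))) block_inj_ortho eq_sym ki.
by rewrite raddf0 mulmx0 !mul0mx.
Qed.

Lemma tr_direct_sum F : \tr (direct_sum F) = \sum_i \tr (F i).
Proof.
rewrite raddf_sum; apply: eq_bigr => i _ /=.
by rewrite mxtrace_mulC mulmxA block_inj_ortho eqxx mul1mx.
Qed.

Lemma psd_direct_sum F : (forall i, psd (F i)) -> psd (direct_sum F).
Proof. by move=> pF; apply: psd_sum => i _; apply: psd_sandwich. Qed.

End DirectSum.

(** * Affinity under instruments and sums *)

Section AffinityBounds.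
Variable C : numClosedFieldType.

(** Data processing for the channel that keeps each outcome [i] in its own block, with Kraus
    operators block_inj i L_i. The root of a direct sum is the direct sum of the roots. *)
Lemma affinity_instrument k l r (L : 'I_r -> 'M[C]_(l, k)) (s t : 'M[C]_k)
    (s' t' : 'I_r -> 'M[C]_l) :
  \sum_(i < r) adj (L i) *m L i = 1%:M -> psd s -> psd t ->
  (forall i, psd (s' i)) -> (forall i, psd (t' i)) ->
  (forall i, L i *m (s *m s) *m adj (L i) = s' i *m s' i) ->
  (forall i, L i *m (t *m t) *m adj (L i) = t' i *m t' i) ->
  \tr (s *m t) <= \sum_(i < r) \tr (s' i *m t' i).
Proof.
move=> L1 ps pt ps' pt' Es Et; rewrite -tr_direct_sum -direct_sumM.
have aux A A' : (forall i, L i *m (A *m A) *m adj (L i) = A' i *m A' i) ->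
    kraus (fun i => block_inj C l i *m L i) (A *m A) =
    direct_sum A' *m direct_sum A'.
  move=> EA; rewrite direct_sumM; apply: eq_bigr => i _.
  by rewrite -EA adjM !mulmxA.
apply: (@affinity_kraus _ _ _ _ (fun i => block_inj C l i *m L i)) => //;
  try exact: psd_direct_sum; try exact: aux.
rewrite -[RHS]L1; apply: eq_bigr => i _.
by rewrite adjM !mulmxA -(mulmxA (adj (L i))) block_inj_ortho eqxx mulmx1.
Qed.

(** Data processing for the partial trace, which adds up the diagonal blocks; it preserves the trace
    by [block_inj_sum]. *)
Lemma affinity_superadditive k r (s' t' : 'I_r -> 'M[C]_k) (s t : 'M[C]_k) :
  psd s -> psd t -> (forall i, psd (s' i)) -> (forall i, psd (t' i)) ->
  \sum_(i < r) s' i *m s' i = s *m s -> \sum_(i < r) t' i *m t' i = t *m t ->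
  \sum_(i < r) \tr (s' i *m t' i) <= \tr (s *m t).
Proof.
move=> ps pt ps' pt' Es Et; rewrite -tr_direct_sum -direct_sumM.
have aux A A' : \sum_(i < r) A' i *m A' i = A *m A ->
    kraus (fun i => adj (block_inj C k i)) (direct_sum A' *m direct_sum A') =
    A *m A.
  move=> <-; apply: eq_bigr => i _.
  by rewrite adjK direct_sumM direct_sum_block.
apply: (@affinity_kraus _ _ _ _ (fun i => adj (block_inj C k i))) => //;
  try exact: psd_direct_sum; try exact: aux.
by rewrite -[RHS]block_inj_sum; apply: eq_bigr => i _; rewrite adjK.
Qed.

(** The squared norm of A - B is nonnegative. This takes the place of Cauchy-Schwarz in the
    optimisations below. *)
Lemma tr_mul_amgm k (A B : 'M[C]_k) : adj A = A -> adj B = B ->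
  \tr (A *m B) *+ 2 <= \tr (A *m A) + \tr (B *m B).
Proof.
move=> hA hB; have := mxtr_mul_adj_ge0 (A - B).
rewrite adjB hA hB mulmxBl !mulmxBr !raddfB /= (mxtrace_mulC B A).
by rewrite opprK [- _ + \tr _]addrC addrACA -opprD subr_ge0 mulr2n.
Qed.

End AffinityBounds.

(** * The dephasing map, its fixed points and the closed form of [CA] *)

Section Dephasing.
Variables (C : numClosedFieldType) (m n : nat).
Notation P i := (@projA C m n i).
Notation D := (@dephA C m n).
Implicit Types s t rho : 'M[C]_(m * n).

Lemma projAE i : P i = diag_mx (\row_x (x %/ n == i)%N%:R).
Proof.
apply/matrixP => x y; rewrite !mxE; case: eqP => [->|_] //=.
Qed.

Lemma adj_projA i : adj (P i) = P i.
Proof.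
apply/matrixP => x y; rewrite !mxE conjC_nat eq_sym.
by case: eqP => [->|].
Qed.

Lemma projA_mul i j : P i *m P j = if i == j then P i else 0.
Proof.
rewrite !projAE mulmx_diag; apply/matrixP => x y; rewrite !mxE -natrM mulnb.
have [->|/eqP ij] := eqVneq i j; rewrite ?andbb !mxE //.
case: (eqVneq (x %/ n)%N i) => [->|_] /=; last by rewrite mul0rn.
by case: eqP => [/val_inj //|_]; rewrite mul0rn.
Qed.

Lemma projA_sum : \sum_i P i = 1%:M.
Proof.
apply/matrixP => x y; rewrite summxE mxE.
have xm : (x %/ n < m)%N.
  have n0 : (0 < n)%N by case: n x {y} => // x; case: x => x; rewrite muln0.
  by rewrite ltn_divLR.
rewrite (bigD1 (Ordinal xm)) //= big1 => [|i ne]; rewrite !mxE ?addr0.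
  by rewrite eqxx andbT.
rewrite (_ : (_ == _ :> nat) = false) ?andbF //.
by apply: contraNF ne => /eqP xi; apply/eqP/val_inj.
Qed.

Lemma projA_dephA s j : P j *m D s = D s *m P j.
Proof.
rewrite mulmx_sumr mulmx_suml; apply: eq_bigr => i _.
rewrite !mulmxA projA_mul -(mulmxA _ (P i) (P j)) projA_mul eq_sym.
by case: eqP => [->|_]; rewrite ?mulmx0 ?mul0mx.
Qed.

(** Commutation with every projector is the convenient form of incoherence: it passes to products
    and, by [sqrt_intertwine], to psd roots. *)
Lemma dephA_fixed s : D s = s <-> forall i, P i *m s = s *m P i.
Proof.
split=> [<- j|H]; first exact: projA_dephA.
rewrite /dephA -[RHS]mulmx1 -projA_sum mulmx_sumr; apply: eq_bigr => i _.
by rewrite H -mulmxA projA_mul eqxx.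
Qed.

Lemma dephA_idem s : D (D s) = D s.
Proof. by apply/dephA_fixed => j; apply: projA_dephA. Qed.

Lemma dephA_scale c s : D (c *: s) = c *: D s.
Proof.
by rewrite scaler_sumr; apply: eq_bigr => i _; rewrite -scalemxAr -scalemxAl.
Qed.

Lemma psd_dephA s : psd s -> psd (D s).
Proof.
move=> ps; apply: psd_sum => i _.
by rewrite -{2}(adj_projA i); apply: psd_sandwich.
Qed.

Lemma tr_dephA s : \tr (D s) = \tr s.
Proof.
rewrite -[in RHS](mulmx1 s) -projA_sum mulmx_sumr !raddf_sum.
apply: eq_bigr => i _ /=.
by rewrite mxtrace_mulC mulmxA projA_mul eqxx mxtrace_mulC.
Qed.

(** As [t] commutes with the projectors, D(s) t = D(s t), and [D] preserves the trace. *)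
Lemma tr_dephA_mul s t : D t = t -> \tr (D s *m t) = \tr (s *m t).
Proof.
move=> /dephA_fixed Pt; rewrite -(tr_dephA (s *m t)); congr (\tr _).
rewrite mulmx_suml; apply: eq_bigr => i _.
by rewrite -!mulmxA Pt.
Qed.

Lemma dephA_sqr s : D s = s -> D (s *m s) = s *m s.
Proof.
move=> /dephA_fixed Ps; apply/dephA_fixed => i.
by rewrite mulmxA Ps -mulmxA Ps mulmxA.
Qed.

Lemma dephA_sqrt s : psd s -> D (s *m s) = s *m s -> D s = s.
Proof.
move=> ps /dephA_fixed H; apply/dephA_fixed => i; apply/esym.
by apply: sqrt_intertwine.
Qed.

Definition deph_sqrt rho := D (msqrt rho).

(** For a density matrix this is the largest squared affinity with an incoherent state. It is
    homogeneous of degree 1, so weights and outcome probabilities can be absorbed into its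
    argument. *)
Definition deph_purity rho := \tr (deph_sqrt rho *m deph_sqrt rho).

Lemma psd_deph_sqrt rho : psd rho -> psd (deph_sqrt rho).
Proof. by case/msqrtP => ps _; apply: psd_dephA. Qed.

Lemma deph_purityE rho : deph_purity rho = \tr (msqrt rho *m deph_sqrt rho).
Proof. by rewrite /deph_purity tr_dephA_mul // dephA_idem. Qed.

Lemma deph_purity_ge0 rho : psd rho -> 0 <= deph_purity rho.
Proof. by move=> /psd_deph_sqrt p; apply: psd_trM_ge0. Qed.

(** Pythagoras: [D] is the Hilbert-Schmidt orthogonal projection onto its fixed points. *)
Lemma deph_purity_gap rho : psd rho ->
  let X := msqrt rho - deph_sqrt rho in
  \tr rho - deph_purity rho = \tr (X *m adj X).
Proof.
move=> pr X; have [ps ss] := msqrtP pr.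
rewrite /X adjB (psd_adj ps) (psd_adj (psd_deph_sqrt pr)) mulmxBl !mulmxBr.
rewrite !raddfB /= ss -deph_purityE (mxtrace_mulC (deph_sqrt _)) -deph_purityE.
by rewrite -/(deph_purity _) subrr addr0.
Qed.

(** If the dephased root vanished, the root itself would be psd of trace 0. *)
Lemma deph_purity_gt0 rho : psd rho -> rho != 0 -> 0 < deph_purity rho.
Proof.
move=> pr r0; rewrite lt_def deph_purity_ge0 // andbT.
apply: contraNneq r0; rewrite /deph_purity -{2}(psd_adj (psd_deph_sqrt pr)).
move=> /mxtr_mul_adj_eq0 D0; have [ps <-] := msqrtP pr.
by rewrite (psd_tr0 ps) ?mul0mx // -tr_dephA -/(deph_sqrt _) D0 mxtrace0.
Qed.

Lemma deph_purityZ c rho : 0 <= c -> psd rho ->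
  deph_purity (c *: rho) = c * deph_purity rho.
Proof.
move=> c0 pr; rewrite /deph_purity /deph_sqrt msqrtZ // dephA_scale.
by rewrite -scalemxAl -scalemxAr scalerA mxtraceZ -expr2 sqrtCK.
Qed.

Lemma deph_purity_superadditive r (rho : 'I_r -> 'M[C]_(m * n)) :
  (forall i, psd (rho i)) ->
  \sum_i deph_purity (rho i) <= deph_purity (\sum_i rho i).
Proof.
move=> pr; set R := \sum_i rho i.
have pR : psd R by apply: psd_sum.
have [pS SS] := msqrtP pR.
pose tau i := deph_sqrt (rho i).
have ptau i : psd (tau i) by apply: psd_deph_sqrt.
(* The sum of the unnormalised optimal incoherent operators for the [rho i], with trace the sum of
   their purities. Superadditivity of the affinity bounds that sum by the overlap of the roots of
   [R] and [sig], and AM-GM bounds twice this overlap by the purity of [R] plus the trace of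
   [sig]. *)
pose sig := \sum_i tau i *m tau i.
have psig : psd sig by apply: psd_sum => i _; apply/psd_sqr/psd_adj.
have Dsig : D sig = sig.
  apply/dephA_fixed => i; rewrite mulmx_sumr mulmx_suml; apply: eq_bigr => j _.
  have /dephA_fixed -> // : D (tau j *m tau j) = tau j *m tau j.
  by apply/dephA_sqr/dephA_idem.
have [pt tt] := msqrtP psig.
have Dt : D (msqrt sig) = msqrt sig by apply: dephA_sqrt => //; rewrite tt.
have trsig : \tr sig = \sum_i deph_purity (rho i) by rewrite raddf_sum.
have : \sum_i deph_purity (rho i) <= \tr (msqrt R *m msqrt sig).
  under eq_bigr do rewrite deph_purityE.
  apply: affinity_superadditive => // [i|]; first by case: (msqrtP (pr i)).
  by rewrite SS; apply: eq_bigr => i _; case: (msqrtP (pr i)).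
rewrite -tr_dephA_mul // -/(deph_sqrt _) -(ler_pMn2r (n := 2)) // => /le_trans H.
have := H _ (tr_mul_amgm (psd_adj (psd_deph_sqrt pR)) (psd_adj pt)).
by rewrite tt trsig mulr2n lerD2r.
Qed.

(** [PIO] speaks of normalised states with nonzero image; homogeneity and the trivial zero cases
    extend it to every incoherent psd operator. *)
Lemma PIO_dephA r (K : 'I_r -> 'M[C]_(m * n)) s i : PIO m n K ->
  psd s -> D s = s -> D (K i *m s *m adj (K i)) = K i *m s *m adj (K i).
Proof.
move=> [_ HK] ps Ds.
have D0 : D 0 = 0 by rewrite -(scale0r s) dephA_scale !scale0r.
have [s0|s0] := eqVneq s 0; first by rewrite s0 mulmx0 mul0mx D0.
have t0 : \tr s != 0 by apply: contraNneq s0 => /(psd_tr0 ps) ->.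
have tp : 0 < \tr s by rewrite lt_def t0 psd_tr_ge0.
have PIs : PIstate m n ((\tr s)^-1 *: s).
  split; last by rewrite dephA_scale Ds.
  by split; [apply: psdZ; rewrite ?invr_ge0 ?ltW | rewrite mxtraceZ mulVf].
have [E|N0] := eqVneq (K i *m s *m adj (K i)) 0; first by rewrite E D0.
have := HK i _ PIs; rewrite -scalemxAr -scalemxAl.
rewrite scaler_eq0 invr_eq0 (negPf t0) (negPf N0) => /(_ isT) [_].
set c := (\tr _)^-1; rewrite scalerA dephA_scale.
apply: scalerI; rewrite mulf_neq0 ?invr_eq0 // mxtraceZ mulf_neq0 ?invr_eq0 //.
by apply: contraNneq N0 => /(psd_tr0 (psd_sandwich (K i) ps)) ->.
Qed.

Lemma deph_purity_PIO r (K : 'I_r -> 'M[C]_(m * n)) rho : PIO m n K ->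
  psd rho -> deph_purity rho <= \sum_i deph_purity (K i *m rho *m adj (K i)).
Proof.
move=> hK pr; have [K1 _] := hK.
have [pS SS] := msqrtP pr; have ptau := psd_deph_sqrt pr.
(* The unnormalised optimal incoherent operator for [rho]. Its images [sigi i] stay incoherent and
   have total trace [deph_purity rho], so data processing followed by AM-GM on each outcome gives
   the bound. *)
pose sig := deph_sqrt rho *m deph_sqrt rho.
have psig : psd sig by apply/psd_sqr/psd_adj.
have Dsig : D sig = sig by apply/dephA_sqr/dephA_idem.
pose rhoi i := K i *m rho *m adj (K i).
pose sigi i := K i *m sig *m adj (K i).
have pri i : psd (rhoi i) by apply: psd_sandwich.
have psi i : psd (sigi i) by apply: psd_sandwich.
have trsig : \sum_i \tr (sigi i) = deph_purity rho.
  transitivity (\tr (sig *m \sum_i adj (K i) *m K i)).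
    rewrite mulmx_sumr raddf_sum; apply: eq_bigr => i _ /=.
    by rewrite /sigi -mulmxA mxtrace_mulC mulmxA.
  by rewrite [X in _ *m X]K1 mulmx1.
have : deph_purity rho <= \sum_i \tr (msqrt (rhoi i) *m msqrt (sigi i)).
  rewrite deph_purityE; apply: (affinity_instrument K1) => // i.
  - by case: (msqrtP (pri i)).
  - by case: (msqrtP (psi i)).
  - by rewrite SS; case: (msqrtP (pri i)).
  - by case: (msqrtP (psi i)).
rewrite -(ler_pMn2r (n := 2)) // -[X in _ <= X]sumrMnl => /le_trans H.
have : deph_purity rho *+ 2 <= \sum_i (deph_purity (rhoi i) + \tr (sigi i)).
  apply: H; apply: ler_sum => i _; have [pt tt] := msqrtP (psi i).
  have Dt : D (msqrt (sigi i)) = msqrt (sigi i).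
    by apply: dephA_sqrt => //; rewrite tt; apply: PIO_dephA.
  rewrite -tr_dephA_mul // -[in X in _ <= _ + X]tt.
  exact: tr_mul_amgm (psd_adj (psd_deph_sqrt (pri i))) (psd_adj pt).
by rewrite big_split /= trsig mulr2n lerD2r.
Qed.

Lemma CA_deph_purity rho : density rho -> CA m n rho = 1 - deph_purity rho.
Proof.
move=> [pr tr1]; have [pS SS] := msqrtP pr; have ptau := psd_deph_sqrt pr.
have r0 : rho != 0 by apply: contra_eq_neq tr1 => ->; rewrite mxtrace0 eq_sym oner_eq0.
have f0 := deph_purity_gt0 pr r0; set f := deph_purity rho in f0 *.
have w0 : 0 < sqrtC f by rewrite sqrtC_gt0.
(* The root of the optimal state: the dephased root of [rho], scaled to Hilbert-Schmidt norm 1. *)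
pose tau := (sqrtC f)^-1 *: deph_sqrt rho.
have pt : psd tau by apply: psdZ; rewrite ?invr_ge0 ?ltW.
have Dtau : D tau = tau by rewrite dephA_scale dephA_idem.
have trtau : \tr (tau *m tau) = 1.
  rewrite -scalemxAl -scalemxAr scalerA mxtraceZ -/(deph_purity rho) -/f.
  by rewrite -invfM -expr2 sqrtCK mulVf ?gt_eqF.
have CAmin : is_CA_min m n rho (1 - f).
  split=> [|s [[ps trs] Ds]].
    exists (tau *m tau).
      by split; [split=> //; apply/psd_sqr/psd_adj | apply: dephA_sqr].
    rewrite /affinity msqrt_sqr // -scalemxAr mxtraceZ -deph_purityE -/f.
    have -> : (sqrtC f)^-1 * f = sqrtC f.
      by rewrite -{2}(sqrtCK f) expr2 mulKf ?gt_eqF.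
    by rewrite sqrtCK.
  have [pt' tt'] := msqrtP ps.
  have Ds' : D (msqrt s) = msqrt s by apply: dephA_sqrt; rewrite ?tt'.
  rewrite lerD2l lerN2 -[f]sqrtCK ler_sqr ?nnegrE ?psd_trM_ge0 ?(ltW w0) //.
  (* Both [tau] and the root of [s] have norm 1, so their overlap is at most 1; multiplying by
     [sqrtC f] bounds the affinity of [rho] and [s]. *)
  have := tr_mul_amgm (psd_adj pt) (psd_adj pt').
  rewrite trtau tt' trs -mulr2n lerMn2r /= -scalemxAl mxtraceZ tr_dephA_mul //.
  by rewrite mulrC ler_pdivrMr // mul1r.
(* [CA] is chosen by [epsilon]: existence of a minimum makes the choice a minimum, and two minima
   bound each other. *)
have [[s Ps E1] E2] : is_CA_min m n rho (CA m n rho).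
  exact: (epsilon_spec (inhabits 0) (is_CA_min m n rho) (ex_intro _ _ CAmin)).
have [[s' Ps' E1'] E2'] := CAmin.
by apply/le_anti; rewrite {1}E1' E2 //= E1 E2'.
Qed.

Lemma density_krausmap r (K : 'I_r -> 'M[C]_(m * n)) rho :
  cptp_kraus K -> density rho -> density (krausmap K rho).
Proof.
move=> K1 [pr tr1]; split; first by apply: psd_sum => i _; apply: psd_sandwich.
rewrite -tr1 -[in RHS](mulmx1 rho) -K1 mulmx_sumr !raddf_sum.
by apply: eq_bigr => i _ /=; rewrite -mulmxA mxtrace_mulC mulmxA.
Qed.

End Dephasing.

Theorem theorem5 (C : numClosedFieldType) (m n : nat) :
  (* (C1) *)
  (forall rho : 'M[C]_(m * n), density rho ->
     0 <= CA m n rho /\ (CA m n rho = 0 <-> PIstate m n rho)) /\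
  (* (C2) *)
  (forall (r : nat) (K : 'I_r -> 'M[C]_(m * n)) (rho : 'M[C]_(m * n)),
     PIO m n K -> density rho ->
     CA m n (krausmap K rho) <= CA m n rho) /\
  (* (C3) *)
  (forall (r : nat) (K : 'I_r -> 'M[C]_(m * n)) (rho : 'M[C]_(m * n)),
     PIO m n K -> density rho ->
     \sum_(l < r | 0 < \tr (K l *m rho *m adj (K l)))
        \tr (K l *m rho *m adj (K l)) *
        CA m n ((\tr (K l *m rho *m adj (K l)))^-1 *: (K l *m rho *m adj (K l)))
     <= CA m n rho) /\
  (* (C4) *)
  (forall (r : nat) (p : 'I_r -> C) (rhos : 'I_r -> 'M[C]_(m * n)),
     (forall l, 0 <= p l) -> \sum_(l < r) p l = 1 ->
     (forall l, density (rhos l)) ->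
     CA m n (\sum_(l < r) p l *: rhos l) <= \sum_(l < r) p l * CA m n (rhos l)).
Proof.
split=> [rho dr|].
2: split=> [r K rho hK dr|]; last split=> [r K rho hK dr|r p rhos p0 p1 dr].
- have [pr tr1] := dr; have [pS SS] := msqrtP pr.
  (* The coherence is the squared distance from the root of [rho] to its dephasing; it vanishes
     exactly when that root, hence [rho], is incoherent. *)
  rewrite CA_deph_purity // -tr1 deph_purity_gap //.
  split; first exact: mxtr_mul_adj_ge0.
  split=> [/mxtr_mul_adj_eq0 /eqP|[_ Dr]].
    rewrite subr_eq0 => /eqP E; split=> //.
    by rewrite -SS; apply: dephA_sqr; rewrite {2}E.
  by rewrite /deph_sqrt dephA_sqrt ?SS // subrr mul0mx mxtrace0.
- have [K1 _] := hK; have [pr _] := dr.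
  rewrite !CA_deph_purity //; last exact: density_krausmap.
  (* The purity does not decrease when passing to the outcomes, nor when summing them. *)
  rewrite lerD2l lerN2; apply: le_trans (deph_purity_PIO hK pr) _.
  by apply: deph_purity_superadditive => i; apply: psd_sandwich.
- have [K1 _] := hK; have [pr tr1] := dr.
  pose rhoi i := K i *m rho *m adj (K i).
  have pri i : psd (rhoi i) by apply: psd_sandwich.
  have E i : 0 < \tr (rhoi i) ->
      \tr (rhoi i) * CA m n ((\tr (rhoi i))^-1 *: rhoi i) =
      \tr (rhoi i) - deph_purity (rhoi i).
    move=> ti; have ti' : 0 <= (\tr (rhoi i))^-1 by rewrite invr_ge0 ltW.
    rewrite CA_deph_purity; last first.
      by split; [apply: psdZ | rewrite mxtraceZ mulVf ?gt_eqF].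
    by rewrite deph_purityZ // mulrBr mulr1 mulrA divff ?gt_eqF // mul1r.
  rewrite (eq_bigr _ E) CA_deph_purity //.
  (* Outcomes of probability 0 have a zero operator and contribute nothing, so the sum may run over
     all [i]. *)
  have -> : \sum_(i < r | 0 < \tr (rhoi i)) (\tr (rhoi i) - deph_purity (rhoi i)) =
      \sum_(i < r) (\tr (rhoi i) - deph_purity (rhoi i)).
    rewrite big_mkcond; apply: eq_bigr => i _; case: ifPn => //.
    rewrite lt_def psd_tr_ge0 // andbT negbK => /eqP t0.
    have -> : rhoi i = 0 by apply: psd_tr0.
    by rewrite mxtrace0 -(scale0r rho) deph_purityZ // mul0r subrr.
  rewrite sumrB; have [_ tr1'] := density_krausmap K1 dr.
  have -> : \sum_i \tr (rhoi i) = 1 by rewrite -tr1' raddf_sum.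
  rewrite lerD2l lerN2.
  exact: deph_purity_PIO.
- have dmix : density (\sum_(l < r) p l *: rhos l).
    split; first by apply: psd_sum => i _; apply: psdZ => //; case: (dr i).
    rewrite raddf_sum -[RHS]p1; apply: eq_bigr => i _ /=.
    by rewrite mxtraceZ; case: (dr i) => _ ->; rewrite mulr1.
  rewrite CA_deph_purity //.
  (* Homogeneity moves each weight inside the purity, which leaves superadditivity. *)
  have -> : \sum_(l < r) p l * CA m n (rhos l) =
      1 - \sum_(l < r) deph_purity (p l *: rhos l).
    rewrite -[X in X - _]p1 -sumrB; apply: eq_bigr => i _.
    by have [pi _] := dr i; rewrite CA_deph_purity // deph_purityZ // mulrBr mulr1.
  rewrite lerD2l lerN2; apply: deph_purity_superadditive => i.
  by apply: psdZ => //; case: (dr i).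
Qed.
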